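(* Let $\Omega$ be an infinite set, $K$ a field, $V$ a $K$-vector space with basis $\Omega$, and let $J$ be any set of cardinality $\le\mathrm{card}(V)$. Then $L^{=}_{\mathrm{End}_K(V),J}$ contains no chains with $>\mathrm{card}(V)$ jumps. Hence for any $K$-algebra $A$ embeddable in $\mathrm{End}_K(V)$, the lattice $L^{=}_{A,J}$ contains no such chains; in particular, it contains no well-ordered or reverse-well-ordered chains of cardinality $>\mathrm{card}(V)$.
   Context: ''$K$-algebra'' means associative unital $K$-algebra; $\mathrm{End}_K(V)$ is the $K$-algebra of all $K$-linear endomorphisms of $V$; $\mathrm{card}(V)=\max(\mathrm{card}(\Omega),\mathrm{card}(K))$. For a $K$-algebra $A$ and a set $J$, a principal solution set in $A^J$ is a set of the form $S_{v=w}=\{a=(a_j)_{j\in J}\in A^J\mid v(a)=w(a)\}$, where $v$ and $w$ are words in a $J$-tuple of variables $(t_j)_{j\in J}$, constants from $A$, and the operations of $K$-algebras (addition, multiplication, multiplication by scalars from $K$, etc.). A solution set in $A^J$ is the intersection of an arbitrary family of principal solution sets (the empty intersection being $A^J$). $L^{=}_{A,J}$ denotes the complete lattice of all solution sets in $A^J$, ordered by inclusion. A chain is a totally ordered subset. A jump in a totally ordered set $C$ is a pair $x<y$ in $C$ such that no $z\in C$ satisfies $x<z<y$. *)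

(* Defs.v *)
From HB Require Import structures.
From mathcomp Require Import all_boot all_order all_algebra.
From mathcomp Require Import all_classical.

Set Implicit Arguments.
Unset Strict Implicit.
Unset Printing Implicit Defensive.

Import Order.TTheory GRing.Theory.

Local Open Scope classical_set_scope.
Local Open Scope card_scope.
Local Open Scope ring_scope.

Definition linearly_independent (K : fieldType) (V : lmodType K)
    (B : set V) : Prop :=
  forall (s : seq V) (c : V -> K), uniq s -> [set` s] `<=` B ->
    \sum_(v <- s) c v *: v = 0 -> forall v, v \in s -> c v = 0.

Definition spanning (K : fieldType) (V : lmodType K) (B : set V) : Prop :=
  forall x : V, exists (s : seq V) (c : V -> K),
    [set` s] `<=` B /\ x = \sum_(v <- s) c v *: v.

Definition is_basis (K : fieldType) (V : lmodType K) (B : set V) : Prop :=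
  linearly_independent B /\ spanning B.

Lemma infinite_set_neq0 (K : fieldType) (V : lmodType K) (B : set V) :
  infinite_set B -> exists v : V, v != 0.
Proof.
move=> Binf; apply: contrapT => /forallNP V0; apply: Binf.
apply: (@sub_finite_set _ _ [set 0]); last exact: finite_set1.
by move=> v _ /=; apply/eqP/negPn/negP; exact: V0.
Qed.

(* The K-algebra of all K-linear endomorphisms of V, with composition as
   product. A proof that V is nonzero is carried in the type because [algType]
   requires [1 != 0]. *)
Definition endK (K : fieldType) (V : lmodType K) (V0 : exists v : V, v != 0) :=
  {linear V -> V}.

Section EndomorphismAlgebra.
Variables (K : fieldType) (V : lmodType K) (V0 : exists v : V, v != 0).
Implicit Types (f g h : endK V0) (k : K).

Lemma endK_eqP f g : f =1 g -> f = g.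
Proof.
case: f g => [f [[fA] [fZ]]] [g [[gA] [gZ]]] /= /funext fg.
rewrite {f}fg in fA fZ *.
by rewrite (Prop_irrelevance fA gA) (Prop_irrelevance fZ gZ).
Qed.

HB.instance Definition _ := gen_eqMixin (endK V0).
HB.instance Definition _ := gen_choiceMixin (endK V0).

Definition endK_zero : endK V0 := \0%R.
Definition endK_opp f : endK V0 := \- f.
Definition endK_add f g : endK V0 := f \+ g.
Definition endK_one : endK V0 := idfun.
Definition endK_mul f g : endK V0 := f \o g.
Definition endK_scale k f : endK V0 := k \*: f.

Lemma endK_addA : associative endK_add.
Proof. by move=> f g h; apply: endK_eqP => x /=; rewrite addrA. Qed.
Lemma endK_addC : commutative endK_add.
Proof. by move=> f g; apply: endK_eqP => x /=; rewrite addrC. Qed.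
Lemma endK_add0 : left_id endK_zero endK_add.
Proof. by move=> f; apply: endK_eqP => x /=; rewrite add0r. Qed.
Lemma endK_addN : left_inverse endK_zero endK_opp endK_add.
Proof. by move=> f; apply: endK_eqP => x /=; rewrite addNr. Qed.

HB.instance Definition _ := GRing.isZmodule.Build (endK V0)
  endK_addA endK_addC endK_add0 endK_addN.

Lemma endK_mulA : associative endK_mul.
Proof. by move=> f g h; apply: endK_eqP. Qed.
Lemma endK_mul1 : left_id endK_one endK_mul.
Proof. by move=> f; apply: endK_eqP. Qed.
Lemma endK_mulr1 : right_id endK_one endK_mul.
Proof. by move=> f; apply: endK_eqP. Qed.
Lemma endK_mulDl : left_distributive endK_mul endK_add.
Proof. by move=> f g h; apply: endK_eqP. Qed.
Lemma endK_mulDr : right_distributive endK_mul endK_add.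
Proof. by move=> f g h; apply: endK_eqP => x /=; rewrite linearD. Qed.
Lemma endK_one_neq0 : endK_one != endK_zero.
Proof.
by have [v v0] := V0; apply: contra_neq v0 => /(congr1 (fun f : endK V0 => f v)).
Qed.

HB.instance Definition _ := GRing.Zmodule_isNzRing.Build (endK V0)
  endK_mulA endK_mul1 endK_mulr1 endK_mulDl endK_mulDr endK_one_neq0.

Lemma endK_scaleA j k f : endK_scale j (endK_scale k f) = endK_scale (j * k) f.
Proof. by apply: endK_eqP => x /=; rewrite scalerA. Qed.
Lemma endK_scale1 : left_id 1 endK_scale.
Proof. by move=> f; apply: endK_eqP => x /=; rewrite scale1r. Qed.
Lemma endK_scaleDr : right_distributive endK_scale endK_add.
Proof. by move=> k f g; apply: endK_eqP => x /=; rewrite scalerDr. Qed.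
Lemma endK_scaleDl f :
  {morph endK_scale^~ f : j k / j + k >-> endK_add j k}.
Proof. by move=> j k; apply: endK_eqP => x /=; rewrite scalerDl. Qed.

HB.instance Definition _ := GRing.Zmodule_isLmodule.Build K (endK V0)
  endK_scaleA endK_scale1 endK_scaleDr endK_scaleDl.

Lemma endK_scaleAl k f g : k *: (f * g) = (k *: f) * g.
Proof. by apply: endK_eqP. Qed.
Lemma endK_scaleAr k f g : k *: (f * g) = f * (k *: g).
Proof. by apply: endK_eqP => x /=; rewrite linearZ. Qed.

HB.instance Definition _ :=
  GRing.Lmodule_isLalgebra.Build K (endK V0) endK_scaleAl.
HB.instance Definition _ :=
  GRing.Lalgebra_isAlgebra.Build K (endK V0) endK_scaleAr.

End EndomorphismAlgebra.

(* [algType] excludes the zero algebra; since morphisms are unital, that algebra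
   embeds in no nonzero algebra, so no case is lost. *)
Definition embeddable (K : fieldType) (A B : algType K) : Prop :=
  exists f : {lrmorphism A -> B}, injective f.

Inductive word (K A J : Type) : Type :=
| WVar of J
| WConst of A
| WZero
| WOne
| WAdd of word K A J & word K A J
| WOpp of word K A J
| WMul of word K A J & word K A J
| WScale of K & word K A J.

Fixpoint word_eval (K : fieldType) (A : algType K) (J : Type)
    (a : J -> A) (w : word K A J) : A :=
  match w with
  | WVar j => a j
  | WConst c => c
  | WZero => 0
  | WOne => 1
  | WAdd u v => word_eval a u + word_eval a v
  | WOpp u => - word_eval a u
  | WMul u v => word_eval a u * word_eval a v
  | WScale k u => k *: word_eval a u
  end.

Definition principal_solution_set (K : fieldType) (A : algType K) (J : Type)
    (v w : word K A J) : set (J -> A) :=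
  [set a | word_eval a v = word_eval a w].

Definition solution_lattice (K : fieldType) (A : algType K) (J : Type) :
    set (set (J -> A)) :=
  [set S | exists2 F : set (set (J -> A)),
    F `<=` [set P | exists v w : word K A J, P = principal_solution_set v w] &
    S = \bigcap_(P in F) P].
Arguments solution_lattice {K} A J.

Definition jumps d (P : porderType d) (C : set P) : set (P * P) :=
  [set p | [/\ C p.1, C p.2, (p.1 < p.2)%O &
    ~ (exists2 z, C z & (p.1 < z < p.2)%O)]].

Definition card_lt T U (A : set T) (B : set U) : Prop :=
  (A #<= B) /\ ~ (B #<= A).

(* Main.v *)
(* Give End(V) the topology of pointwise convergence with V discrete, and A^J
   the induced product topology; it has a base indexed by finite sequences in
   J * V * V, hence of cardinality at most card V. All operations are
   continuous, so words are continuous and solution sets are closed. If X < Y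
   is a jump in a chain C of closed sets, some basic open set U meets Y but not
   X. In C, this U meets exactly the members strictly above X, so it determines
   the jump, and C has at most card V jumps. In a well-ordered chain every
   element except the maximum is the lower end of a jump, and dually. *)
Require Import Defs.
From mathcomp Require Import all_boot all_order all_algebra.
From mathcomp Require Import all_classical wochoice.

Import Order.TTheory GRing.Theory.

Local Open Scope classical_set_scope.
Local Open Scope card_scope.

(** * Cardinal arithmetic: comparability, squares, products and finite sequences *)

Lemma card_le_setTP (T U : Type) :
  [set: T] #<= [set: U] <-> exists f : T -> U, injective f.
Proof.
split=> [/card_leP[f]|[f f_inj]].
  exists (fun x => val (f (to_setT x))) => x y /val_inj.
  by move=> /(inj (in_setT _) (in_setT _)) /(congr1 val).
have /card_eqPle[_ /card_le_trans] := @inj_card_eq _ _ [set: T] f (in2W f_inj).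
by apply; exact: card_leT.
Qed.

Lemma in_inj_card_le (T U : Type) (A : set T) (f : T -> U) :
  {in A &, injective f} -> A #<= [set: U].
Proof.
move=> f_inj; have /card_eqPle[_ /card_le_trans] := inj_card_eq f_inj.
by apply; exact: card_leT.
Qed.

(** Zorn's lemma on graphs of partial injections from [A] to [B]: a maximal one exhausts [A] or [B],
    since otherwise a pair of missed points could be adjoined. *)
Lemma card_le_total (T U : Type) (A : set T) (B : set U) :
  A #<= B \/ B #<= A.
Proof.
(* The biconditional makes [G] functional and injective at once. *)
pose P : set (set (T * U)) := [set G | G `<=` A `*` B /\
  {in G &, forall p q, p.1 = q.1 <-> p.2 = q.2}].
have [F FP F_tot|G [[GAB G_inj] G_max]] := @Zorn_bigcup _ P.
  split=> [p [G /FP[+ _]]|p q]; first exact.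
  rewrite !inE => -[G FG Gp] [H FH Hq].
  have [GH|HG] := F_tot _ _ FG FH.
    by have [_ /(_ p q)] := FP _ FH; rewrite !inE; apply=> //; exact: GH.
  by have [_ /(_ p q)] := FP _ FG; rewrite !inE; apply=> //; exact: HG.
have G1 : fst @` G #= G.
  apply: inj_card_eq => -[a b] [a' b'] Gp Gq /= e.
  by have [/(_ e)/= -> _] := G_inj _ _ Gp Gq; rewrite e.
have G2 : snd @` G #= G.
  apply: inj_card_eq => -[a b] [a' b'] Gp Gq /= e.
  by have [_ /(_ e)/= ->] := G_inj _ _ Gp Gq; rewrite e.
have G1B : fst @` G #<= B.
  rewrite (card_le_eql G1) -(card_le_eql G2); apply: subset_card_le.
  by move=> _ [p /GAB[]/= _ ? <-].
have G2A : snd @` G #<= A.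
  rewrite (card_le_eql G2) -(card_le_eql G1); apply: subset_card_le.
  by move=> _ [p /GAB[]/= ? _ <-].
have [AG|/existsNP[a /not_implyP[Aa Ga]]] := pselect (A `<=` fst @` G).
  by left; apply: card_le_trans (subset_card_le AG) G1B.
have [BG|/existsNP[b /not_implyP[Bb Gb]]] := pselect (B `<=` snd @` G).
  by right; apply: card_le_trans (subset_card_le BG) G2A.
case: (G_max ((a, b) |` G)).
  split; first by move=> p Gp; right.
  by move=> /(_ (a, b) (or_introl erefl)) Gab; apply: Ga; exists (a, b).
split=> [_ [->|/GAB//]|p q]; first by split.
rewrite !inE => -[->|Gp] [->|Gq] //=.
- by split=> e; [case: Ga|case: Gb]; exists q.
- by split=> e; [case: Ga|case: Gb]; exists p.
- by apply: G_inj; rewrite inE.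
Qed.

Definition self_pairing {T : Type} (A : set T) (f : T * T -> T) : Prop :=
  set_fun (A `*` A) A f /\ set_inj (A `*` A) f.

(** Zorn's lemma on pairs of a carrier and a pairing, ordered by extension. The two distinct points
    serve later as tags for a disjoint union. *)
Lemma maximal_self_pairing (T : pointedType) :
  infinite_set [set: T] ->
  exists (A : set T) (f : T * T -> T), [/\ exists x y, [/\ A x, A y & x <> y],
    self_pairing A f &
    forall B g, self_pairing B g -> A `<=` B -> {in A `*` A, f =1 g} ->
      B `<=` A].
Proof.
move=> /infiniteP/card_le_setTP[i i_inj].
have [p p_inj] : exists p : nat * nat -> nat, injective p.
  by apply/card_le_setTP; case/card_eqPle: card_nat2.
pose ok (X : set T * (T * T -> T)) :=
  [/\ X.1 (i 0%N), X.1 (i 1%N) & self_pairing X.1 X.2].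
pose le (X Y : set T * (T * T -> T)) :=
  X.1 `<=` Y.1 /\ {in X.1 `*` X.1, X.2 =1 Y.2}.
have [||C Cok C_wo|[A f] /asboolP[/= A0 A1 Af] Af_max] :=
  @Zorn's_lemma _ (fun X Y => `[< le X Y >]) (fun X => `[< ok X >]);
  last first.
- exists A, f; split=> // [|B g Bg AB fg].
    by exists (i 0%N), (i 1%N); split=> // /i_inj.
  have /(Af_max (B, g)) : `[< ok (B, g) >].
    by apply/asboolP; split=> //=; exact: AB.
  have le_fg : `[< le (A, f) (B, g) >] by apply/asboolP.
  by move=> /(_ le_fg)/asboolP[].
- have /= C_tot := wo_chainW C_wo.
  (* The empty chain is bounded by the countable set [range i], with the pairing of [nat] carried
     over by [i]. *)
  have [[X0 CX0]|C0] := pselect (nonempty C); last first.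
    pose j x := xget 0%N [set n | i n = x].
    have ij n : j (i n) = n.
      by rewrite /j; case: xgetP => [m _ /= /i_inj//|/(_ n)/= /(_ erefl)].
    exists (range i, fun xy => i (p (j xy.1, j xy.2))).
      apply/asboolP; split=> /=; [by exists 0%N|by exists 1%N|split].
        by move=> [x y] _; exists (p (j x, j y)).
      move=> [x y] [x' y']; rewrite !inE => -[/= [k _ <-] [l _ <-]].
      by move=> [/= [k' _ <-] [l' _ <-]]; rewrite !ij => /i_inj/p_inj[-> ->].
    by move=> Y CY; case: C0; exists Y.
  pose D := [set x | exists2 Y, Y \in C & Y.1 x].
  (* Since the chain is total, both coordinates already lie in a single carrier. *)
  have D2 q : (D `*` D) q -> exists2 Y, Y \in C & (Y.1 `*` Y.1) q.
    move=> [[Y CY Yx] [Z CZ Zy]].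
    by have /orP[/asboolP[YZ _]|/asboolP[ZY _]] := C_tot _ _ CY CZ;
      [exists Z|exists Y] => //; split=> //; [exact: YZ|exact: ZY].
  (* The value does not depend on [Y]: of two members of the chain, one extends the other. *)
  pose g q := get [set z | exists Y, [/\ Y \in C, (Y.1 `*` Y.1) q & z = Y.2 q]].
  have gE Y q : Y \in C -> (Y.1 `*` Y.1) q -> g q = Y.2 q.
    move=> CY Yq; rewrite /g; case: xgetP => [z _ [Z [CZ Zq ->]]|].
      have /orP[/asboolP[_ ->]|/asboolP[_ ->]] // := C_tot _ _ CY CZ;
        by rewrite inE.
    by move=> /(_ (Y.2 q))[]; exists Y.
  exists (D, g); last first.
    move=> Y CY; apply/asboolP; split=> /= [x Yx|q]; first by exists Y.
    by rewrite inE => Yq; rewrite (gE Y).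
  apply/asboolP; have /asboolP[/= X00 X01 _] := Cok _ CX0.
  split=> /=; [by exists X0|by exists X0|split].
    move=> q /D2[Y CY Yq]; rewrite (gE Y)//; exists Y => //.
    by have /asboolP[_ _ [+ _]] := Cok _ CY; exact.
  move=> q r; rewrite !inE => /D2[Y CY Yq] /D2[Z CZ Zr].
  rewrite (gE Y)// (gE Z)//.
  have /asboolP[_ _ [_ Y_inj]] := Cok _ CY.
  have /asboolP[_ _ [_ Z_inj]] := Cok _ CZ.
  have /orP[/asboolP[YZ eYZ]|/asboolP[ZY eZY]] := C_tot _ _ CY CZ.
    rewrite eYZ ?inE//; apply: Z_inj; rewrite inE//.
    by case: Yq => *; split; exact: YZ.
  rewrite eZY ?inE//; apply: Y_inj; rewrite inE//.
  by case: Zr => *; split; exact: ZY.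
- move=> X2 X1 X3 _ _ _ /asboolP[s12 e12] /asboolP[s23 e23]; apply/asboolP.
  split=> [x /s12/s23//|q]; rewrite inE => -[x1 y1].
  by rewrite e12 ?inE// e23// inE; split; exact: s12.
- by move=> Y _; apply/asboolP; split.
Qed.

(** Take a maximal pairing, with carrier [A]. If the complement of [A] injects into [A], then all of
    [T * T] injects into [A]. Otherwise the complement contains a copy of [A], over which the
    pairing extends, against maximality. *)
Lemma card_setXT_le (T : Type) :
  infinite_set [set: T] -> [set: T * T] #<= [set: T].
Proof.
elim/Ppointed: T => T Tinf.
  by case: Tinf; rewrite emptyE; exact: finite_set0.
have [A [f [[a0 [a1 [Aa0 Aa1 a01]]] [fA f_inj] Af_max]]] :=
  maximal_self_pairing T Tinf.
have {}f_inj x y x' y' : A x -> A y -> A x' -> A y' ->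
    f (x, y) = f (x', y') -> x = x' /\ y = y'.
  move=> Ax Ay Ax' Ay' e.
  have := f_inj (x, y) (x', y'); rewrite !inE.
  by move=> /(_ (conj Ax Ay) (conj Ax' Ay') e)[].
have {}fA x y : A x -> A y -> A (f (x, y)) by move=> Ax Ay; exact: fA.
(* A set B disjoint from A that injects into A is absorbed by it, so that
   (A `|` B)^2 still injects into A. *)
have absorb B (h : T -> T) : B `<=` ~` A -> set_fun B A h -> set_inj B h ->
    exists2 e : T * T -> T, set_fun ((A `|` B) `*` (A `|` B)) A e
                          & set_inj ((A `|` B) `*` (A `|` B)) e.
  move=> BA hA h_inj.
  (* The tags [a0] and [a1] keep the images of [A] and [B] apart. *)
  pose e x := if x \in A then f (a0, x) else f (a1, h x).
  have eA x : (A `|` B) x -> A (e x).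
    rewrite /e; case: ifPn => [|]; rewrite ?inE ?notin_setE => Ax.
      by move=> _; exact: fA.
    by case=> // /hA ?; exact: fA.
  have e_inj x y : (A `|` B) x -> (A `|` B) y -> e x = e y -> x = y.
    rewrite /e; case: ifPn => [|]; rewrite ?inE ?notin_setE => Ax;
      case: ifPn => [|]; rewrite ?inE ?notin_setE => Ay.
    - by move=> _ _ /f_inj[].
    - by move=> _ [//|/hA ?] /f_inj[].
    - by move=> [//|/hA ?] _ /f_inj[]// /esym.
    - move=> [//|Bx] [//|By] /f_inj[]//; [exact: hA|exact: hA|].
      by move=> _ /h_inj; apply; rewrite inE.
  exists (fun q => f (e q.1, e q.2)) => [q [ABx ABy]|[x y] [x' y']].
    by apply: fA; exact: eA.
  rewrite !inE => -[/= ABx ABy] [/= ABx' ABy'] /f_inj[]; try exact: eA.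
  by move=> /e_inj -> // /e_inj ->.
have [/pcard_leP[k]|/pcard_leP[h]] := card_le_total _ _ A (~` A); last first.
  have [||e _ e_inj] := absorb (~` A) h (@subset_refl _ _).
  - by move=> x /= Ax; exact: funS.
  - by move=> x y xA yA; exact: inj.
  apply: (@in_inj_card_le _ _ _ e) => q r _ _; apply: e_inj.
    by rewrite setUv inE.
  by rewrite setUv inE.
pose B := k @` A; pose h x := get [set a | A a /\ k a = x].
have hK a : A a -> h (k a) = a.
  move=> Aa; rewrite /h; case: xgetP => [b _ /= [Ab]|/(_ a)/= []//].
  by apply: inj; rewrite inE.
have BA : B `<=` ~` A by move=> _ [a Aa <-]; exact: (@funS _ _ _ _ k).
have [_ [a Aa <-]||e eA e_inj] := absorb B h BA; first by rewrite hK.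
  by move=> x y; rewrite !inE => -[a Aa <-] [b Ab <-]; rewrite !hK// => ->.
(* New pairs go into [A] by [e] and then into [B] by [k], so their values avoid those of the old
   pairs, which lie in [A]. *)
pose f' q := if q \in A `*` A then f q else k (e q).
have f'B q : ((A `|` B) `*` (A `|` B)) q -> ~ (A `*` A) q -> B (f' q).
  by move=> ABq Aq; rewrite /f' memNset//; exists (e q) => //; exact: eA.
have f'A q : (A `*` A) q -> A (f' q).
  by move=> Aq; rewrite /f' mem_set//; case: q Aq => x y [/= Ax Ay]; exact: fA.
(* Maximality would put [B] inside [A], yet [k a0] lies outside [A]. *)
case: (BA (k a0)); first by exists a0.
apply: (Af_max (A `|` B) f'); [split| | |by right; exists a0].
- move=> q ABq; have [Aq|Aq] := pselect ((A `*` A) q).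
    by left; exact: f'A.
  by right; exact: f'B.
- move=> q r; rewrite !inE => ABq ABr.
  have [Aq|Aq] := pselect ((A `*` A) q);
    have [Ar|Ar] := pselect ((A `*` A) r) => qr.
  + move: qr; rewrite /f' !mem_set//.
    by case: q r Aq Ar {ABq ABr} => [x y] [x' y'] [? ?] [? ?] /f_inj[]// -> ->.
  + by case: (BA _ (f'B _ ABr Ar)); rewrite -qr; exact: f'A.
  + by case: (BA _ (f'B _ ABq Aq)); rewrite qr; exact: f'A.
  + move: qr; rewrite /f' !memNset// => /inj; rewrite !inE.
    by move=> /(_ (eA _ ABq) (eA _ ABr)) /e_inj; apply; rewrite inE.
- by move=> x; left.
- by move=> q Aq; rewrite /f' Aq.
Qed.

Lemma card_prod_le (T U W : Type) :
  infinite_set [set: T] -> [set: U] #<= [set: T] -> [set: W] #<= [set: T] ->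
  [set: U * W] #<= [set: T].
Proof.
move=> Tinf /card_le_setTP[f f_inj] /card_le_setTP[g g_inj].
apply: card_le_trans (card_setXT_le _ Tinf); apply/card_le_setTP.
by exists (fun q => (f q.1, g q.2)) => -[u w] [u' w'] [/f_inj -> /g_inj ->].
Qed.

(** A list is coded by its length together with the nested pairing of its entries. The length tells
    where decoding stops, as the end value [i 0] may itself be the code of a pair. *)
Lemma card_seq_le (T U : Type) :
  infinite_set [set: T] -> [set: U] #<= [set: T] -> [set: seq U] #<= [set: T].
Proof.
move=> Tinf /card_le_setTP[f f_inj].
have /infiniteP/card_le_setTP[i i_inj] := Tinf.
have /card_le_setTP[p p_inj] := card_setXT_le _ Tinf.
apply/card_le_setTP.
exists (fun s => p (i (size s), foldr (fun x y => p (f x, y)) (i 0%N) s)).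
move=> s t /p_inj[/i_inj]; elim: s t => [|x s IH] [|y t]//= [st].
by move=> /p_inj[/f_inj -> /IH ->].
Qed.

Lemma card_setU1_le (T U : Type) (x : T) (A : set T) :
  infinite_set [set: U] -> A #<= [set: U] -> (x |` A) #<= [set: U].
Proof.
elim/Ppointed: U => U Uinf.
  by case: Uinf; rewrite emptyE; exact: finite_set0.
move=> /pcard_injP[f f_inj].
apply: card_le_trans (card_seq_le _ _ Uinf (card_lexx _)).
(* Elements of [A] go to singletons, which leaves the empty list for [x] when [x] lies outside
   [A]. *)
apply: (@in_inj_card_le _ _ _ (fun y => if y \in A then [:: f y] else [::])).
move=> y z; rewrite !inE => yxA zxA.
case: ifPn => [yA|]; case: ifPn => [zA|] //.
  by case=> /f_inj; exact.
rewrite !notin_setE => zA yA _.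
by case: yxA zxA => [->|//] [->|].
Qed.

(** * Counting the jumps of a chain *)

(** The second hypothesis expresses that members of [C] are closed, with [B] in the role of a base.
    A jump is sent to a chosen member of [B] separating its ends, and this map is injective. *)
Lemma card_jumps_le (T : Type) (C B : set (set T)) :
  chain <=%O (mem C) ->
  (forall S p, C S -> ~ S p -> exists U, [/\ B U, U p & U `&` S = set0]) ->
  jumps C #<= B.
Proof.
move=> C_chain C_closed.
pose sep (X Y U : set T) := [/\ B U, U `&` Y !=set0 & U `&` X = set0].
have sepP X Y : jumps C (X, Y) -> sep X Y (get (sep X Y)).
  move=> [CX CY + _]; rewrite properEset => -[_ /existsNP[p]].
  move=> /not_implyP[Yp Xp]; have [U [BU Up UX]] := C_closed _ _ CX Xp.
  by apply: (getI (x := U)); split=> //; exists p.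
have C_tot X Y : C X -> C Y -> (X <= Y)%O \/ (Y < X)%O.
  move=> CX CY; have [->|YX] := eqVneq Y X; first by left; exact: lexx.
  have /orP[|XY] := C_chain X Y (mem_set CX) (mem_set CY); first by left.
  by right; rewrite lt_neqAle YX.
have sep_lt X Y Z W U : C Y -> C Z -> sep X Y U -> sep Z W U -> (Z < Y)%O.
  move=> CY CZ [_ [p [Up Yp]] _] [_ _ UZ].
  have [/subsetPset/(_ p Yp) Zp|//] := C_tot _ _ CY CZ.
  by have : set0 p by rewrite -UZ.
have le_jump X Y Z W : jumps C (X, Y) -> C Z -> C W -> (Z < Y)%O -> (X < W)%O ->
    (Z <= X)%O /\ (Y <= W)%O.
  move=> [/= CX CY _ XY] CZ CW ZY XW; split.
    have [//|XZ] := C_tot _ _ CZ CX.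
    by case: XY; exists Z => //; rewrite XZ.
  have [//|WY] := C_tot _ _ CY CW.
  by case: XY; exists W => //; rewrite XW.
have /card_eqPle[_ /card_le_trans] :
    (fun P => get (sep P.1 P.2)) @` jumps C #= jumps C.
  apply: inj_card_eq => -[X Y] [X' Y']; rewrite !inE => jP jQ /= e.
  have sP := sepP _ _ jP; have sQ := sepP _ _ jQ; rewrite -e in sQ.
  have [/= CX CY _ _] := jP; have [/= CX' CY' _ _] := jQ.
  (* The common separating set puts each lower end strictly below the other upper end. As no member
     of [C] lies inside a jump, the ends then compare both ways. *)
  have X'Y := sep_lt _ _ _ _ _ CY CX' sP sQ.
  have XY' := sep_lt _ _ _ _ _ CY' CX sQ sP.
  have [X'X YY'] := le_jump _ _ _ _ jP CX' CY' X'Y XY'.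
  have [XX' Y'Y] := le_jump _ _ _ _ jQ CX CY XY' X'Y.
  by congr (_, _); apply/le_anti/andP.
apply; apply: subset_card_le => _ [[X Y] /sepP[BU _ _] <-]; exact: BU.
Qed.

(** There are no more lower ends of jumps than jumps, and a possible maximum adds a single point,
    which an infinite [U] absorbs. *)
Lemma card_wo_chain_le d (P : porderType d) (C : set P) (U : Type) :
  infinite_set [set: U] -> wo_chain <=%O (mem C) -> jumps C #<= [set: U] ->
  C #<= [set: U].
Proof.
move=> Uinf C_wo jU.
have C1U : fst @` jumps C #<= [set: U].
  exact: card_le_trans (card_image_le _ _) jU.
have succ x y : C x -> C y -> (x < y)%O -> (fst @` jumps C) x.
  move=> Cx Cy xy; have [||z [[/andP[/set_mem Cz xz] z_min] _]] :=
      C_wo (fun z => (z \in C) && (x < z)%O).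
  - by move=> z /andP[].
  - by exists y; apply/andP; split=> //; rewrite inE.
  exists (x, z) => //; split=> //= -[t Ct /andP[xt tz]].
  have := z_min t; rewrite [_ \in _]/in_mem/= xt mem_set// => /(_ isT).
  by rewrite lt_geF.
have C_chain := wo_chainW C_wo.
have [[m Cm m_max]|Cmax] :=
    pselect (exists2 m, C m & forall y, C y -> ~ (m < y)%O).
  apply: card_le_trans (card_setU1_le _ _ m _ Uinf C1U); apply: subset_card_le.
  move=> x Cx; have [<-|/eqP xm] := pselect (x = m); first by left.
  right; apply: (succ x m) => //.
  have /orP[xm'|mx] := C_chain x m (mem_set Cx) (mem_set Cm).
    by rewrite lt_neqAle xm.
  by case: (m_max x Cx); rewrite lt_neqAle eq_sym xm.
apply: card_le_trans C1U; apply: subset_card_le => x Cx.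
apply: contrapT => jx; apply: Cmax; exists x => // y Cy xy.
by apply: jx; exact: succ xy.
Qed.

(** In the dual order the chain is well-ordered, and its jumps are the original ones with their ends
    swapped. *)
Lemma card_rev_wo_chain_le d (P : porderType d) (C : set P) (U : Type) :
  infinite_set [set: U] -> wo_chain >=%O (mem C) -> jumps C #<= [set: U] ->
  C #<= [set: U].
Proof.
move=> Uinf C_wo jU; apply: (@card_wo_chain_le _ P^d) => //.
apply: card_le_trans jU.
apply: (card_le_trans _ (card_image_le (fun p : P * P => (p.2, p.1)) _)).
apply: subset_card_le => -[x y] [/= Cx Cy xy xyN]; exists (y, x) => //.
by split=> //= -[z Cz /andP[yz zx]]; apply: xyN; exists z => //; apply/andP.
Qed.

(** * The topology on [J -> A] and the closedness of solution sets *)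

(** Basic open sets of the topology pulled back along [f]; working through [f] treats every
    embeddable algebra at once. *)
Definition basic_open {K : fieldType} {V : lmodType K}
    {V0 : exists v : V, v != 0%R} {A : algType K}
    (f : {lrmorphism A -> endK V0}) {J : Type} (s : seq (J * V * V)) :
    set (J -> A) :=
  [set a | all (fun t => (f (a t.1.1) : {linear V -> V}) t.1.2 == t.2) s].

(** Continuity at [p] of the word evaluated at [x], with [V] discrete. The induction keeps [x]
    general because products are compositions. *)
Lemma word_eval_locally_constant (K : fieldType) (V : lmodType K)
    (V0 : exists v : V, v != 0%R) (A : algType K)
    (f : {lrmorphism A -> endK V0}) (J : Type)
    (w : word K A J) (x : V) (p : J -> A) :
  exists2 s, basic_open f s p & forall a, basic_open f s a ->
    (f (word_eval a w) : {linear V -> V}) x =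
    (f (word_eval p w) : {linear V -> V}) x.
Proof.
elim: w x => [j|c| | |u IHu v IHv|u IHu|u IHu v IHv|k u IHu] x /=.
- exists [:: (j, x, (f (p j) : {linear V -> V}) x)].
    by rewrite /basic_open /= eqxx.
  by move=> a; rewrite /basic_open /= andbT => /eqP.
- by exists [::].
- by exists [::].
- by exists [::].
- have [s ps su] := IHu x; have [t pt tv] := IHv x.
  exists (s ++ t); rewrite /basic_open /= ?all_cat; first exact/andP.
  move=> a; rewrite all_cat => /andP[/su ea /tv eb].
  by rewrite !rmorphD /= ea eb.
- by have [s ps su] := IHu x; exists s => // a /su ea; rewrite !rmorphN /= ea.
(* The left factor acts on the image of [x] under the right one, and [t] keeps this image equal to
   its value at [p]. *)
- have [t pt tv] := IHv x.
  have [s ps su] := IHu ((f (word_eval p v) : {linear V -> V}) x).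
  exists (s ++ t); rewrite /basic_open /= ?all_cat; first exact/andP.
  move=> a; rewrite all_cat => /andP[/su ea /tv eb].
  by rewrite !rmorphM /= eb ea.
- by have [s ps su] := IHu x; exists s => // a /su ea; rewrite !linearZ /= ea.
Qed.

(** A point outside [S] violates some equation. Injectivity of [f] gives a vector [x] where the two
    sides differ, and local constancy keeps them different on a basic open set. *)
Lemma solution_set_closed (K : fieldType) (V : lmodType K)
    (V0 : exists v : V, v != 0%R) (A : algType K)
    (f : {lrmorphism A -> endK V0}) (J : Type)
    (S : set (J -> A)) (p : J -> A) :
  injective f -> solution_lattice A J S -> ~ S p ->
  exists U, [/\ range (basic_open f) U, U p & U `&` S = set0].
Proof.
move=> f_inj [F F_principal ->] /existsNP[Q /not_implyP[FQ]].
have [v [w Qvw]] := F_principal _ FQ; rewrite {1}Qvw => vwp.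
have [x fx] : exists x, (f (word_eval p v) : {linear V -> V}) x
                     <> (f (word_eval p w) : {linear V -> V}) x.
  by apply/existsNP => fvw; apply: vwp; apply: f_inj; exact: endK_eqP.
have [s ps sv] := word_eval_locally_constant _ _ _ _ f _ v x p.
have [t pt tw] := word_eval_locally_constant _ _ _ _ f _ w x p.
exists (basic_open f (s ++ t)); split; first by exists (s ++ t).
  by rewrite /basic_open /= all_cat; exact/andP.
rewrite -subset0 => a []; rewrite /basic_open /= all_cat.
move=> /andP[/sv av /tw aw] /(_ _ FQ); rewrite Qvw => e.
by apply: fx; rewrite -av -aw e.
Qed.

Lemma card_jumps_solution_lattice (K : fieldType) (V : lmodType K)
    (V0 : exists v : V, v != 0%R) (A : algType K) (J : Type)
    (C : set (set (J -> A))) :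
  infinite_set [set: V] -> [set: J] #<= [set: V] -> embeddable A (endK V0) ->
  C `<=` solution_lattice A J -> chain <=%O (mem C) ->
  jumps C #<= [set: V].
Proof.
move=> Vinf JV [f f_inj] C_sol C_chain.
have seqV : [set: seq (J * V * V)] #<= [set: V].
  by apply: card_seq_le => //; apply: card_prod_le => //; exact: card_prod_le.
apply: card_le_trans seqV.
apply: card_le_trans (card_image_le (basic_open f) _).
apply: card_jumps_le => // S p /C_sol; exact: solution_set_closed.
Qed.

Theorem theorem8p1 (K : fieldType) (V : lmodType K) (Omega : set V)
    (Omega_infinite : infinite_set Omega) (Omega_basis : is_basis Omega)
    (J : Type) (J_small : [set: J] #<= [set: V]) :
  let E := endK (infinite_set_neq0 Omega_infinite) in
  ~ (exists C : set (set (J -> E)),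
       [/\ C `<=` solution_lattice E J, chain <=%O (mem C)
         & card_lt [set: V] (jumps C)]) /\
  (forall A : algType K, embeddable A E ->
    [/\ ~ (exists C : set (set (J -> A)),
             [/\ C `<=` solution_lattice A J, chain <=%O (mem C)
               & card_lt [set: V] (jumps C)]),
        ~ (exists C : set (set (J -> A)),
             [/\ C `<=` solution_lattice A J, wo_chain <=%O (mem C)
               & card_lt [set: V] C])
      & ~ (exists C : set (set (J -> A)),
             [/\ C `<=` solution_lattice A J, wo_chain >=%O (mem C)
               & card_lt [set: V] C])]).
Proof.
move=> E.
have Vinf : infinite_set [set: V].
  by move=> Vfin; apply: (Omega_infinite); apply: sub_finite_set Vfin.
have jumps_le A : embeddable A E -> forall C : set (set (J -> A)),
    C `<=` solution_lattice A J -> chain <=%O (mem C) -> jumps C #<= [set: V].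
  move=> AE C.
  exact: (card_jumps_solution_lattice _ _ _ _ _ C Vinf J_small AE).
(* The identity embedding makes the claim about [E] itself an instance of the bound. *)
have E_emb : embeddable E E by exists idfun.
split=> [[C [C_sol C_chain [_]]]|A AE]; first by apply; exact: jumps_le.
split=> -[C [C_sol C_chain [_]]]; apply; first exact: jumps_le.
  by apply: card_wo_chain_le => //; apply: jumps_le => //; exact: wo_chainW.
apply: card_rev_wo_chain_le => //; apply: jumps_le => // X Y CX CY.
by rewrite orbC; exact: (wo_chainW C_chain).
Qed.
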